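(* Consider either of the following two settings. (Real) $\Omega\subset\mathbb R^n$ is a bounded smooth uniformly convex domain, $f\in C^\infty(\overline\Omega)$ is positive, $u\in C^\infty(\overline\Omega)$ is strictly convex with $\det D^2u=f$ in $\Omega$ and $u|_{\partial\Omega}=\varphi$, and $L_uh=\operatorname{cof}(D^2u):D^2h$. (Complex) $\Omega\subset\mathbb C^n$ is a bounded strongly pseudoconvex domain with smooth boundary, $f\in C^\infty(\overline\Omega)$ is positive, $u\in C^\infty(\overline\Omega)$ is strictly plurisubharmonic with $(dd^cu)^n=f\,dV$ in $\Omega$ and $u|_{\partial\Omega}=\varphi$, and $L_uh\,dV=n\,dd^ch\wedge(dd^cu)^{n-1}$. Let $x\in\Omega$ and let $\omega_u^x$ be the harmonic measure for $L_u$ at $x$. Let $\varphi_t=\varphi+t\psi$ with $\psi:\partial\Omega\to\mathbb R$, and suppose that the corresponding solutions $u_t$ (strictly convex with $\det D^2u_t=f$ in the real case, strictly plurisubharmonic with $(dd^cu_t)^n=f\,dV$ in the complex case, with $u_t|_{\partial\Omega}=\varphi_t$ and $u_0=u$) exist for $|t|$ small, with the same right-hand side $f$, and depend smoothly on $(t,y)$, $y\in\overline\Omega$. Then $$\left.\frac{d}{dt}\right|_{t=0}u_t(x)=\int_{\partial\Omega}\psi\,d\omega_u^x .$$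
   Context: $A:B=\operatorname{tr}(AB)$ for symmetric matrices; $\operatorname{cof}$ is the cofactor matrix; $dV$ is Lebesgue measure; $dd^c$ is a fixed positive multiple of $i\partial\bar\partial$. The harmonic measure $\omega_u^x$ for the operator $L_u$ at $x\in\Omega$ is the measure on $\partial\Omega$ such that $h(x)=\int_{\partial\Omega}g\,d\omega_u^x$ whenever $L_uh=0$ in $\Omega$ and $h|_{\partial\Omega}=g$. *)

(* Defs.v *)
From HB Require Import structures.
From mathcomp Require Import all_boot all_order all_algebra perm.
From mathcomp Require Import all_classical all_reals all_analysis.
From mathcomp Require Import complex.

Set Implicit Arguments.
Unset Strict Implicit.
Unset Printing Implicit Defensive.

Import Order.TTheory GRing.Theory Num.Theory.
Import numFieldNormedType.Exports.

Local Open Scope classical_set_scope.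
Local Open Scope ring_scope.

Section Smoothness.
Context {R : realType} {E : normedModType R}.
Implicit Types (f : E -> R) (O S : set E).

Definition iter_derive (s : seq E) f : E -> R :=
  foldr (fun v g => 'D_v g) f s.

(* In finite dimension this is the usual class C^k: all partial derivatives
   of order at most k exist and are continuous on the open set O. *)
Definition class_C (k : nat) O f : Prop :=
  forall s : seq E, (size s <= k)%N ->
    {within O, continuous (iter_derive s f)} /\
    ((size s < k)%N ->
      forall x v, O x -> derivable (iter_derive s f) x v).

Definition smooth_on O f : Prop := forall k, class_C k O f.

(* For O open and O `<=` S `<=` closure O: f is C^oo in O, and f and all of
   its derivatives extend continuously from O to S. *)
Definition smooth_upto O S f : Prop :=
  [/\ smooth_on O f,
      {within S, continuous f} &
      forall s : seq E, exists2 g : E -> R,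
        {within S, continuous g} & forall x, O x -> g x = iter_derive s f x].

End Smoothness.

Section Domains.
Context {R : realType} {E : normedModType R}.
Implicit Types (Om : set E).

Definition boundary Om : set E := closure Om `\` interior Om.

Definition smooth_closure Om (f : E -> R) : Prop :=
  smooth_upto Om (closure Om) f.

(* The family (u_t), |t| < eps, is C^oo in (t, y) for y in closure Om. *)
Definition smooth_family (eps : R) Om (ut : R -> E -> R) : Prop :=
  smooth_upto [set p : R * E | `|p.1| < eps /\ Om p.2]
              [set p : R * E | `|p.1| < eps /\ closure Om p.2]
              (fun p => ut p.1 p.2).

Definition bounded_domain Om : Prop :=
  [/\ open Om, connected Om, Om !=set0 & bounded_set Om].

Definition local_defining_function Om (p : E) (rho : E -> R) : Prop :=
  exists U : set E,
    [/\ open_nbhs p U, smooth_on U rho,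
        (exists v, 'D_v rho p != 0) &
        Om `&` U = [set y | rho y < 0] `&` U].

Definition smooth_boundary Om : Prop :=
  forall p, boundary Om p -> exists rho, local_defining_function Om p rho.

Definition borel : Type := g_sigma_algebraType (@open E).

HB.instance Definition _ := Measurable.on borel.

(* omega is a Borel measure on the boundary (extended by 0 to E) representing
   every solution of L h = 0 that is C^2 inside and continuous up to the
   boundary; L h takes values in T. *)
Definition is_harmonic_measure (T : zmodType) Om (L : (E -> R) -> E -> T)
    (x : E) (omega : {measure set borel -> \bar R}) : Prop :=
  omega (~` boundary Om) = 0%E /\
  forall g h : E -> R,
    class_C 2 Om h -> {within closure Om, continuous h} ->
    (forall y, Om y -> L h y = 0) ->
    (forall y, boundary Om y -> h y = g y) ->
    (h x)%:E = (\int[omega]_(y in boundary Om) (g y)%:E)%E.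

End Domains.
Arguments borel {R} E.

Section RealSetting.
Context {R : realType} {n : nat}.
Local Notation E := 'rV[R]_n.
Implicit Types (Om : set E) (u h rho : E -> R).

Definition evec (j : 'I_n) : E := delta_mx 0 j.

Definition hessian u (x : E) : 'M[R]_n :=
  \matrix_(i, j) 'D_(evec i) ('D_(evec j) u) x.

Definition cof_mx (A : 'M[R]_n) : 'M[R]_n := \matrix_(i, j) cofactor A i j.

Definition contraction (A B : 'M[R]_n) : R := \tr (A *m B).

Definition L_real u h (x : E) : R :=
  contraction (cof_mx (hessian u x)) (hessian h x).

(* The norm of 'rV[R]_n in the library is the sup norm. *)
Definition eucl_norm (v : E) : R := Num.sqrt (\sum_j v 0 j ^+ 2).

Definition gradient rho (p : E) : E := \row_j 'D_(evec j) rho p.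

(* The second fundamental form of the boundary in the direction of a tangent
   vector v is D^2 rho(v, v) / |grad rho|; all principal curvatures are
   required to be at least kappa. *)
Definition uniformly_convex Om : Prop :=
  convex_set Om /\
  exists2 kappa : R, 0 < kappa &
    forall p rho (v : E),
      boundary Om p -> local_defining_function Om p rho ->
      'D_v rho p = 0 ->
      kappa * eucl_norm (gradient rho p) * eucl_norm v ^+ 2
        <= \sum_i \sum_j hessian rho p i j * v 0 i * v 0 j.

Definition strictly_convex Om u : Prop :=
  forall (x y : E) (t : R), Om x -> Om y -> x != y -> 0 < t < 1 ->
    u (t *: x + (1 - t) *: y) < t * u x + (1 - t) * u y.

Definition real_MA_solution Om (f phi u : E -> R) : Prop :=
  [/\ smooth_closure Om u,
      strictly_convex Om u,
      forall y, Om y -> \det (hessian u y) = f y &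
      forall y, boundary Om y -> u y = phi y].

End RealSetting.

Section ComplexSetting.
Local Open Scope complex_scope.
Context {R : realType} {n : nat}.

(* C^n as a real vector space: (x, y) stands for x + iy. *)
Definition Cn : normedModType R := ('rV[R]_n * 'rV[R]_n)%type.

Implicit Types (Om : set Cn) (u h rho : Cn -> R).

Definition xvec (j : 'I_n) : Cn := (delta_mx 0 j, 0).
Definition yvec (j : 'I_n) : Cn := (0, delta_mx 0 j).

Definition deriveC (v : Cn) (F : Cn -> R[i]) (p : Cn) : R[i] :=
  'D_v (fun q => complex.Re (F q)) p +i* 'D_v (fun q => complex.Im (F q)) p.

Definition d_z (j : 'I_n) (F : Cn -> R[i]) (p : Cn) : R[i] :=
  2^-1 * (deriveC (xvec j) F p - (0 +i* 1) * deriveC (yvec j) F p).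

Definition d_zbar (j : 'I_n) (F : Cn -> R[i]) (p : Cn) : R[i] :=
  2^-1 * (deriveC (xvec j) F p + (0 +i* 1) * deriveC (yvec j) F p).

Definition d_z_zbar (j k : 'I_n) u (p : Cn) : R[i] :=
  d_z j (d_zbar k (fun q => (u q)%:C)) p.

Definition levi_form u (p : Cn) (w : 'rV[R[i]]_n) : R[i] :=
  \sum_j \sum_k d_z_zbar j k u p * w 0 j * conjc (w 0 k).

(* In R[i], 0 < z means that z is real and positive. *)
Definition strictly_psh Om u : Prop :=
  forall (p : Cn) (w : 'rV[R[i]]_n), Om p -> w != 0 -> 0 < levi_form u p w.

Definition strongly_pseudoconvex Om : Prop :=
  forall p rho (w : 'rV[R[i]]_n),
    boundary Om p -> local_defining_function Om p rho ->
    w != 0 -> \sum_j d_z j (fun q => (rho q)%:C) p * w 0 j = 0 ->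
    0 < levi_form rho p w.

(* Complex-valued 2-forms at a point. *)
Definition form2 : Type := Cn -> Cn -> R[i].

(* Forms of top degree 2n, the 2n arguments being indexed by 'I_n * bool. *)
Definition topform : Type := ('I_n * bool -> Cn) -> R[i].

Definition dz (j : 'I_n) (v : Cn) : R[i] := v.1 0 j +i* v.2 0 j.
Definition dzbar (j : 'I_n) (v : Cn) : R[i] := conjc (dz j v).

Definition wedge1 (a b : Cn -> R[i]) : form2 :=
  fun v w => a v * b w - a w * b v.

Definition i_ddbar u (p : Cn) : form2 := fun v w =>
  (0 +i* 1) * \sum_j \sum_k d_z_zbar j k u p * wedge1 (dz j) (dzbar k) v w.

(* c is the normalisation constant of dd^c. *)
Definition ddc (c : R) u (p : Cn) : form2 := fun v w =>
  c%:C * i_ddbar u p v w.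

(* The exterior product of n 2-forms, that is
   1 / (2!)^n \sum_s sgn(s) \prod_k a_k (v_s(2k), v_s(2k+1)). *)
Definition wedge (a : 'I_n -> form2) : topform := fun v =>
  (2 ^+ n)^-1 *
  \sum_(s : {perm 'I_n * bool})
    (-1) ^+ s * \prod_k a k (v (s (k, false))) (v (s (k, true))).

Definition std_frame (kb : 'I_n * bool) : Cn :=
  if kb.2 then yvec kb.1 else xvec kb.1.

(* The function g such that T = g dV: the Lebesgue volume form
   dx_1 /\ dy_1 /\ ... /\ dx_n /\ dy_n equals 1 on the standard frame. *)
Definition dV_coef (T : topform) : R[i] := T std_frame.

Definition L_complex (c : R) u h (p : Cn) : R[i] :=
  n%:R * dV_coef
    (wedge (fun k => if val k == 0 :> nat then ddc c h p else ddc c u p)).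

Definition complex_MA_solution (c : R) Om (f phi u : Cn -> R) : Prop :=
  [/\ smooth_closure Om u,
      strictly_psh Om u,
      forall y, Om y -> dV_coef (wedge (fun=> ddc c u y)) = (f y)%:C &
      forall y, boundary Om y -> u y = phi y].

End ComplexSetting.
Arguments Cn : clear implicits.

(* Main.v *)
(* Let h be the derivative of u_t at t = 0.  It is smooth in the domain and
   continuous up to the boundary, where it equals psi.  Differentiating the
   Monge-Ampere equation of u_t at t = 0 gives L_u h = 0: the left-hand side is a
   multilinear expression in the second derivatives of u_t, and d/dt commutes
   with these by the symmetry of mixed derivatives.  Hence h(x) is the integral
   of psi against the harmonic measure at x. *)

Require Import Defs.
From mathcomp Require Import all_boot all_order all_algebra fingroup perm.
From mathcomp Require Import all_classical all_reals all_analysis.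
From mathcomp Require Import complex ring.
Import Order.TTheory GRing.Theory Num.Theory.
Import numFieldNormedType.Exports.
Local Open Scope classical_set_scope.
Local Open Scope ring_scope.

Set Implicit Arguments.
Unset Strict Implicit.
Unset Printing Implicit Defensive.

(** * Directional derivatives and the symmetry of second derivatives *)

Lemma le_of_half_dist (R : realFieldType) (a b c e : R) :
  `|a - c| < e / 2 -> `|c - b| < e / 2 -> `|a - b| <= e.
Proof.
move=> ac cb; rewrite (le_trans (ler_distD c a b))// [e]splitr.
by apply: lerD; apply: ltW.
Qed.

Section DirectionalDerivatives.
Context {R : realType}.

(** An affine map sends the line through [x] along [v] to the line through [g x] along [w], so both
    difference quotients are the same function of [h]. Derivatives are thereby transported along
    translations, lines and slices without a chain rule. *)
Lemma affine_quotient (V W : normedModType R) (f : W -> R) (g : V -> W) x v w :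
  (forall h, g (h *: v + x) = h *: w + g x) ->
  (fun h => h^-1 *: (((f \o g) \o shift x) (h *: v) - (f \o g) x)) =
  (fun h => h^-1 *: ((f \o shift (g x)) (h *: w) - f (g x))).
Proof. by move=> gE; apply/funext => h /=; rewrite gE. Qed.

Lemma derive_affine (V W : normedModType R) (f : W -> R) (g : V -> W) x v w :
  (forall h, g (h *: v + x) = h *: w + g x) ->
  'D_v (f \o g) x = 'D_w f (g x).
Proof. by move=> gE; rewrite /derive (affine_quotient f gE). Qed.

Lemma derivable_affine (V W : normedModType R) (f : W -> R) (g : V -> W) x v w :
  (forall h, g (h *: v + x) = h *: w + g x) ->
  derivable f (g x) w -> derivable (f \o g) x v.
Proof. by move=> gE; rewrite /derivable (affine_quotient f gE). Qed.

Context {V : normedModType R}.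
Implicit Types (f : V -> R) (O : set V).

Lemma MVT_directional f p v (s : R) : 0 < s ->
  (forall r, 0 <= r <= s -> derivable f (p + r *: v) v) ->
  exists2 r, 0 <= r <= s & f (p + s *: v) - f p = s * 'D_v f (p + r *: v).
Proof.
move=> s0 fv; pose g (r : R) := p + r *: v.
have gE r h : g (h *: 1 + r) = h *: v + g r.
  by rewrite /g scalerDl addrCA /GRing.scale/= mulr1.
have dg r : r \in `[0, s] -> derivable (f \o g) r 1.
  by rewrite in_itv/= => rs; apply: derivable_affine (gE r) (fv r rs).
have [||r rs E] := @MVT R (f \o g) (fun r => 'D_v f (g r)) 0 s s0.
- move=> r rs; rewrite -(derive_affine f (gE r)); apply/derivableP/dg.
  exact: subset_itv_oo_cc.
- by apply: derivable_within_continuous => r rs; exact: dg.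
exists r; first by move: rs; rewrite in_itv/= => /andP[/ltW-> /ltW->].
by move: E; rewrite /= /g scale0r addr0 subr0 mulrC.
Qed.

Lemma open_ball_sub O p : open O -> O p ->
  exists2 r : R, 0 < r & forall q, `|q - p| < r -> O q.
Proof.
move=> oO Op; have /nbhs_ballP[r r0 rO] : nbhs p O by apply: open_nbhs_nbhs.
by exists r => // q qp; apply: rO; rewrite -ball_normE /= distrC.
Qed.

Lemma continuous_at_dist f p (e : R) : {for p, continuous f} -> 0 < e ->
  exists2 r : R, 0 < r & forall q, `|q - p| < r -> `|f p - f q| < e.
Proof.
move=> /cvgrPdist_lt/(_ e) fp e0; have /nbhs_ballP[r r0 rf] := fp e0.
by exists r => // q qp; apply: rf; rewrite -ball_normE /= distrC.
Qed.

Lemma class_C_derivable k O f s v x : class_C k O f -> (size s < k)%N ->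
  O x -> derivable (iter_derive s f) x v.
Proof. by move=> fk sk Ox; apply: (fk s (ltnW sk)).2. Qed.

Lemma class_C_continuous k O f s x : open O -> class_C k O f ->
  (size s <= k)%N -> O x -> {for x, continuous (iter_derive s f)}.
Proof.
move=> oO fk sk Ox; have [+ _] := fk s sk.
by rewrite continuous_open_subspace// => /(_ x); apply; rewrite inE.
Qed.

(* Both mixed derivatives are limits of the second difference quotient of f
   over the parallelogram spanned by d v and d w, by two applications of the
   mean value theorem. *)
Lemma class_C2_deriveC O f p v w : open O -> class_C 2 O f -> O p ->
  'D_v ('D_w f) p = 'D_w ('D_v f) p.
Proof.
move=> oO f2 Op; apply/eqP; rewrite -subr_eq0 -normr_le0.
apply/ler_addgt0Pr => e e0; rewrite add0r.
have e2 : 0 < e / 2 by rewrite divr_gt0.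
have cvw : {for p, continuous ('D_v ('D_w f))}.
  exact: (@class_C_continuous 2 O f [:: v; w]).
have cwv : {for p, continuous ('D_w ('D_v f))}.
  exact: (@class_C_continuous 2 O f [:: w; v]).
have [r1 r10 r1P] := open_ball_sub oO Op.
have [r2 r20 r2P] := continuous_at_dist cvw e2.
have [r3 r30 r3P] := continuous_at_dist cwv e2.
pose r := Num.min r1 (Num.min r2 r3).
have r0 : 0 < r by rewrite !lt_min r10 r20 r30.
have rP q : `|q - p| < r ->
    [/\ O q, `|'D_v ('D_w f) p - 'D_v ('D_w f) q| < e / 2
      & `|'D_w ('D_v f) p - 'D_w ('D_v f) q| < e / 2].
  by rewrite !lt_min => /and3P[q1 q2 q3]; split; [exact: r1P|exact: r2P|exact: r3P].
(* This size keeps the whole parallelogram within r / 2 of p; the summand 1 keeps the denominator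
   positive when v and w both vanish. *)
pose d := r / 2 / (`|v| + `|w| + 1).
have vw0 : 0 < `|v| + `|w| + 1 by rewrite ltr_wpDl// addr_ge0.
have d0 : 0 < d by rewrite !divr_gt0.
have inP s t : 0 <= s <= d -> 0 <= t <= d -> `|p + s *: v + t *: w - p| < r.
  move=> /andP[s0 sd] /andP[t0 td].
  rewrite -(addrA p) [p + _]addrC addrK (le_lt_trans (ler_normD _ _))//.
  rewrite !normrZ !ger0_norm//.
  apply: (@le_lt_trans _ _ (d * (`|v| + `|w| + 1))).
    by rewrite !mulrDr mulr1 ler_wpDr ?(ltW d0)// lerD// ler_wpM2r.
  by rewrite /d divfK ?gt_eqF// ltr_pdivrMr// ltr_pMr// ltr1n.
have d00 : (0 : R) <= 0 <= d by rewrite lexx ltW.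
have ddd : 0 <= d <= d by rewrite lexx ltW.
have key a b : (forall s t, 0 <= s <= d -> 0 <= t <= d -> O (p + s *: a + t *: b)) ->
  exists s t, [/\ 0 <= s <= d, 0 <= t <= d &
    f (p + d *: a + d *: b) - f (p + d *: a) - f (p + d *: b) + f p
      = d * (d * 'D_b ('D_a f) (p + s *: a + t *: b))].
  move=> abO.
  (* The second difference is the increment of [g] along [a]. The mean value theorem for [g] leaves
     an increment of ['D_a f] along [b], to which the theorem is applied again. *)
  pose g := (f \o (fun q => q + d *: b)) - f.
  have df q : O q -> derivable f q a.
    by move=> Oq; apply: (@class_C_derivable 2 O f [::]).
  have gE q h : (h *: a + q) + d *: b = h *: a + (q + d *: b) by rewrite addrA.
  have dga s : 0 <= s <= d -> derivable (f \o (fun q => q + d *: b)) (p + s *: a) a.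
    by move=> sd; apply: derivable_affine (gE _) (df _ (abO _ _ sd ddd)).
  have dg s : 0 <= s <= d -> derivable g (p + s *: a) a.
    move=> sd; apply: derivableB; first exact: dga.
    by apply: df; have := abO _ _ sd d00; rewrite scale0r addr0.
  have [s sd gs] := MVT_directional d0 dg.
  have [t td ft] : exists2 t, 0 <= t <= d &
      'D_a f (p + s *: a + d *: b) - 'D_a f (p + s *: a)
        = d * 'D_b ('D_a f) (p + s *: a + t *: b).
    apply: (@MVT_directional ('D_a f) (p + s *: a) b d d0) => t td.
    by apply: (@class_C_derivable 2 O f [:: a]) => //; exact: abO.
  exists s, t; split => //; rewrite -ft.
  move: gs; rewrite deriveB; [|exact: dga|]; last first.
    by apply: df; have := abO _ _ sd d00; rewrite scale0r addr0.
  rewrite (derive_affine f (gE (p + s *: a))) => <-.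
  by rewrite /g !fctE /= opprB [f p - _]addrC addrA.
have vwO s t : 0 <= s <= d -> 0 <= t <= d -> O (p + s *: v + t *: w).
  by move=> sd td; have [] := rP _ (inP _ _ sd td).
have [s [t [sd td E1]]] := key v w vwO.
have wvO s' t' : 0 <= s' <= d -> 0 <= t' <= d -> O (p + s' *: w + t' *: v).
  by move=> sd' td'; rewrite addrAC; have [] := rP _ (inP _ _ td' sd').
have [s' [t' [sd' td' E2]]] := key w v wvO.
(* The second difference is symmetric in v and w, so after cancelling d twice the two mixed
   derivatives agree at two nearby points; continuity carries this to p up to e. *)
have E : 'D_w ('D_v f) (p + s *: v + t *: w) = 'D_v ('D_w f) (p + s' *: w + t' *: v).
  apply: (mulfI (lt0r_neq0 d0)); apply: (mulfI (lt0r_neq0 d0)).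
  apply: etrans (esym E1) (etrans _ E2).
  by rewrite (addrAC p) (addrAC (f _)).
have [_ _ H1] := rP _ (inP _ _ sd td).
have [_ H2 _] := rP _ (inP _ _ td' sd').
rewrite (addrAC p) in H2; rewrite E distrC in H1.
exact: le_of_half_dist H2 H1.
Qed.

End DirectionalDerivatives.

(** An e/3 estimate for boundary values: [b] is a difference quotient in time at an interior point,
    [c] the one at a boundary point, and moving between the points changes each of the two values
    involved by less than e / 3 * t. *)
Lemma difference_quotient_dist (R : realFieldType) (t a b c e x1 x2 x3 x4 : R) :
  0 < t -> `|a - b| < e / 3 -> `|x1 - x2| < e / 3 * t -> `|x3 - x4| < e / 3 * t ->
  x2 - x4 = t * b -> x1 - x3 = t * c -> `|a - c| <= e.
Proof.
move=> t0 ab x12 x34 E1 E2; rewrite -(ler_pM2r t0) -{1}(gtr0_norm t0) -normrM.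
have -> : (a - c) * t = (a - b) * t + ((x3 - x4) - (x1 - x2)).
  by rewrite mulrBl [c * t]mulrC -E2 mulrBl [b * t]mulrC -E1; ring.
rewrite (le_trans (ler_normD _ _))// normrM (gtr0_norm t0).
have -> : e * t = e / 3 * t + (e / 3 * t + e / 3 * t) by field.
apply: lerD; first by rewrite ler_pM2r// ltW.
by rewrite (le_trans (ler_normB _ _))// lerD// ltW.
Qed.

(** * The t-derivative of a smooth family and its extension to the boundary *)

Section SmoothFamilies.
Context {R : realType} {E : normedModType R}.
Implicit Types (f : E -> R) (O : set E).

Lemma within_dist (V : normedModType R) (S : set V) (f : V -> R) p (e : R) :
  {within S, continuous f} -> S p -> 0 < e ->
  exists2 r : R, 0 < r & forall q, S q -> `|q - p| < r -> `|f p - f q| < e.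
Proof.
move=> /subspace_continuousP fS Sp e0.
have /cvgrPdist_lt/(_ e e0) := fS p Sp.
rewrite near_withinE => /nbhs_ballP[r r0 rf].
by exists r => // q Sq qp; apply: rf => //; rewrite -ball_normE /= distrC.
Qed.

Lemma closure_dist O p (r : R) : closure O p -> 0 < r ->
  exists2 q, O q & `|q - p| < r.
Proof.
move=> clOp r0; have [q [Oq qp]] := clOp _ (nbhsx_ballx p r r0).
by exists q => //; move: qp; rewrite -ball_normE /= distrC.
Qed.

Lemma iter_derive_eq_on (V : normedModType R) (O : set V) (f g : V -> R) s x :
  open O -> (forall y, O y -> f y = g y) -> O x ->
  iter_derive s f x = iter_derive s g x.
Proof.
move=> oO fg; elim: s x => [|v s IH] x Ox /=; first exact: fg.
apply: near_eq_derive; apply: filterS (open_nbhs_nbhs (conj oO Ox)).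
exact: IH.
Qed.

Lemma iter_derive_cat (V : normedModType R) (f : V -> R) s s' :
  iter_derive (s ++ s') f = iter_derive s (iter_derive s' f).
Proof. exact: foldr_cat. Qed.

Lemma smooth_on_iter_derive (V : normedModType R) (O : set V) (f : V -> R) s :
  smooth_on O f -> smooth_on O (iter_derive s f).
Proof.
move=> fO k s' s'k; rewrite -iter_derive_cat.
have [cf df] := fO (k + size s)%N (s' ++ s) (ltac:(by rewrite size_cat leq_add2r)).
by split => // s'k1; apply: df; rewrite size_cat ltn_add2r.
Qed.

(** Induction on [s]: symmetry of second derivatives, applied to the smooth function
    [iter_derive s f], moves [v] past the outermost direction. *)
Lemma derive_iter_deriveC (V : normedModType R) (O : set V) (f : V -> R) s v x :
  open O -> smooth_on O f -> O x ->
  'D_v (iter_derive s f) x = iter_derive s ('D_v f) x.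
Proof.
move=> oO fO; elim: s x => [//|w s IH] x Ox /=.
have sf2 : class_C 2 O (iter_derive s f) by exact: smooth_on_iter_derive.
rewrite (class_C2_deriveC v w oO sf2 Ox).
exact: (@iter_derive_eq_on _ O _ _ [:: w]).
Qed.

(** Freezing t is an affine embedding, so spatial derivatives of a slice are derivatives of the
    family along the directions [(0, v)]. Regularity on the cylinder thus passes to slices. *)
Lemma iter_derive_slice (G : R * E -> R) t s :
  iter_derive s (fun y => G (t, y)) =
  (fun y => iter_derive [seq (0, v) | v <- s] G (t, y)).
Proof.
elim: s => [//|v s IH] /=; rewrite IH; apply/funext => y.
apply: (derive_affine (iter_derive [seq (0, v0) | v0 <- s] G)
          (g := pair t) (w := (0, v))) => h.
by congr pair; rewrite /= scaler0 add0r.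
Qed.

Variables (eps : R) (Om : set E) (ut : R -> E -> R).
Hypotheses (eps_gt0 : 0 < eps) (oOm : open Om) (ut_smooth : smooth_family eps Om ut).

Let cylinder := [set p : R * E | `|p.1| < eps /\ Om p.2].
Let F (p : R * E) := ut p.1 p.2.
Let dt : R * E := (1, 0).

Let cylinder_open : open cylinder.
Proof.
have -> : cylinder = fst @^-1` (ball (0 : R) eps) `&` snd @^-1` Om.
  by apply/seteqP; split => p; rewrite /= -ball_normE /= sub0r normrN.
apply: openI; apply: open_comp => //.
- by move=> p _; exact: cvg_fst.
- exact: ball_open.
- by move=> p _; exact: cvg_snd.
Qed.

Let F_smooth : smooth_on cylinder F.
Proof. by have [] := ut_smooth. Qed.

Let cylinder0 y : Om y -> cylinder (0, y).
Proof. by move=> Omy; split => //=; rewrite normr0. Qed.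

Let shift_time (t s : R) (y : E) : (t, y) + s *: dt = (t + s, y).
Proof. by congr pair; rewrite /= ?scaler0 ?addr0// /GRing.scale/= mulr1. Qed.

Let variation_smooth (k : nat) : class_C k Om (fun y => 'D_dt F (0, y)).
Proof.
move=> s sk.
have Fk : class_C k cylinder ('D_dt F).
  by have := @smooth_on_iter_derive _ cylinder F [:: dt] F_smooth k.
pose s' : seq (R * E) := [seq (0, v) | v <- s].
rewrite (iter_derive_slice ('D_dt F) 0) -/s'.
have s'k : (size s' <= k)%N by rewrite size_map.
have gE (y v : E) (h : R) : (0 : R, h *: v + y) = h *: (0, v) + (0, y).
  by congr pair; rewrite /= scaler0 add0r.
split.
  rewrite continuous_open_subspace// => y; rewrite inE => Omy.
  apply: (@continuous_comp _ _ _ (pair 0) (iter_derive s' ('D_dt F))).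
    exact: (cvg_pair (cvg_cst _) cvg_id).
  exact: class_C_continuous cylinder_open Fk s'k (cylinder0 Omy).
move=> sk1 y v Omy.
have d : derivable (iter_derive s' ('D_dt F)) (0, y) (0, v).
  have s'k1 : (size s' < k)%N by rewrite size_map.
  exact: (class_C_derivable Fk s'k1 (cylinder0 Omy)).
exact: (derivable_affine (gE y v) d).
Qed.

(* h is the continuous extension g (0, -) of the t-derivative at t = 0.  On the
   boundary, the mean value theorem at interior points z close to y compares
   (u_t(z) - u_0(z)) / t with g (0, y), and letting z tend to y turns this
   quotient into psi y. *)
Lemma variation_extension (phi psi : E -> R) :
  (forall t y, `|t| < eps -> boundary Om y -> ut t y = phi y + t * psi y) ->
  exists h : E -> R, [/\ class_C 2 Om h, {within closure Om, continuous h},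
    (forall y, boundary Om y -> h y = psi y) &
    forall s y, Om y ->
      is_derive (0 : R) 1 (fun t => iter_derive s (ut t) y) (iter_derive s h y)].
Proof.
move=> utb; have [_ Fcont /(_ [:: dt])[g gcont gE]] := ut_smooth.
have hE y : Om y -> g (0, y) = 'D_dt F (0, y).
  by move=> Omy; exact: gE (cylinder0 Omy).
pose S := [set p : R * E | `|p.1| < eps /\ closure Om p.2].
have S0 y : closure Om y -> S (0, y) by move=> ?; split => //=; rewrite normr0.
exists (fun y => g (0, y)); split.
- move=> s s2; have [cs ds] := variation_smooth s2.
  have sE := iter_derive_eq_on s oOm hE.
  split.
    apply: subspace_eq_continuous cs => y; rewrite inE => /sE; exact: esym.
  move=> s1 y v Omy; apply: near_eq_derivable (ds s1 y v Omy).
  by apply: filterS (open_nbhs_nbhs (conj oOm Omy)) => z /sE.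
- apply/subspace_continuousP => y cly; apply/cvgrPdist_lt => e e0.
  have [r r0 rg] := within_dist gcont (S0 y cly) e0.
  rewrite near_withinE; apply/nbhs_ballP; exists r => // z.
  rewrite -ball_normE /= => yz clz; apply: rg; first exact: S0.
  by rewrite prod_normE/= subrr normr0 gt_max r0 distrC.
- move=> y bdy; have cly : closure Om y by case: bdy.
  apply/eqP; rewrite -subr_eq0 -normr_le0; apply/ler_addgt0Pr => e e0; rewrite add0r.
  have e30 : 0 < e / 3 by rewrite divr_gt0.
  have [r r0 rg] := within_dist gcont (S0 y cly) e30.
  (* Below [eps], so that [ut t] belongs to the family; below [r], so that every intermediate time
     stays where [g] is controlled. *)
  pose t := Num.min eps r / 2.
  have m0 : 0 < Num.min eps r by rewrite lt_min eps_gt0.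
  have t0 : 0 < t by rewrite divr_gt0.
  have /andP[teps tr] : (t < eps) && (t < r).
    by rewrite -lt_min ltr_pdivrMr// ltr_pMr// ltr1n.
  have et0 : 0 < e / 3 * t by rewrite mulr_gt0.
  have Sty : S (t, y) by split => //=; rewrite ger0_norm// ltW.
  have [r1 r10 r1F] := within_dist Fcont Sty et0.
  have [r2 r20 r2F] := within_dist Fcont (S0 y cly) et0.
  (* The interior point z is chosen after t, because the radii [r1] and [r2] answer to the tolerance
     e / 3 * t. *)
  have rr0 : 0 < Num.min r (Num.min r1 r2) by rewrite !lt_min r0 r10.
  have [z Omz] := closure_dist cly rr0.
  rewrite !lt_min => /and3P[zr zr1 zr2].
  have clz : closure Om z by exact: subset_closure.
  have tcyl s : 0 <= s <= t -> cylinder (s, z).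
    by move=> /andP[s0 st]; split => //=; rewrite ger0_norm// (le_lt_trans st).
  have dF s : 0 <= s <= t -> derivable F ((0, z) + s *: dt) dt.
    move=> st; rewrite shift_time add0r.
    exact: (@class_C_derivable _ _ 1 cylinder F [:: ] dt _ (@F_smooth 1) isT (tcyl s st)).
  have [s st FE] := MVT_directional t0 dF.
  move: FE; rewrite !shift_time !add0r => FE.
  have gsz : g (s, z) = 'D_dt F (s, z) by exact: gE (tcyl s st).
  have dist_pair a b : `|((a, z) : R * E) - (b, y)| = Num.max `|a - b| `|z - y|.
    by rewrite prod_normE.
  have H1 : `|g (0, y) - g (s, z)| < e / 3.
    apply: rg; first by split => //=; case: (tcyl s st).
    case/andP: st => s0 st.
    by rewrite dist_pair subr0 gt_max ger0_norm// (le_lt_trans st).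
  have H2 : `|F (t, y) - F (t, z)| < e / 3 * t.
    apply: r1F; first by split => //=; rewrite ger0_norm// ltW.
    by rewrite dist_pair subrr normr0 gt_max r10.
  have H3 : `|F (0, y) - F (0, z)| < e / 3 * t.
    by apply: r2F; [exact: S0|rewrite dist_pair subrr normr0 gt_max r20].
  apply: (difference_quotient_dist t0 H1 H2 H3); first by rewrite gsz.
  rewrite /F /= !utb// ?normr0// ?ger0_norm ?ltW//.
  by rewrite mul0r addr0 addrC addKr.
- move=> s y Omy; pose s' : seq (R * E) := [seq (0, v) | v <- s].
  have utE : (fun t => iter_derive s (ut t) y) = iter_derive s' F \o (fun t => (t, y)).
    apply/funext => t /=.
    by rewrite -[RHS](congr1 (fun G => G y) (iter_derive_slice F t s)).
  have gA (h : R) : (h *: 1 + 0 : R, y) = h *: dt + (0, y).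
    by congr pair; rewrite /= ?scaler0 ?add0r// /GRing.scale/= mulr1.
  have s'C : class_C 1 cylinder (iter_derive s' F) by exact: smooth_on_iter_derive.
  have d : derivable (iter_derive s' F) (0, y) dt.
    exact: (@class_C_derivable _ _ 1 cylinder _ [:: ] dt _ s'C isT (cylinder0 Omy)).
  rewrite utE; apply: DeriveDef; first exact: (derivable_affine gA d).
  rewrite (derive_affine (iter_derive s' F) gA).
  (* The time derivative is moved inside the spatial ones, where on the slice t = 0 it is [h]. *)
  rewrite (derive_iter_deriveC s' dt cylinder_open F_smooth (cylinder0 Omy)).
  rewrite (iter_derive_eq_on s oOm hE Omy).
  by rewrite (iter_derive_slice ('D_dt F) 0).
Qed.

End SmoothFamilies.

(** * The Leibniz rule for an abstract derivation at 0, serving real and complex values alike *)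

Section LeibnizRule.
Context {R T : comPzRingType}.
(* [D F l] stands for "F has derivative l at 0". *)
Variable D : (R -> T) -> T -> Prop.
Hypothesis D_cst : forall c, D (fun=> c) 0.
Hypothesis D_add : forall F G a b, D F a -> D G b -> D (fun t => F t + G t) (a + b).
Hypothesis D_mul : forall F G a b,
  D F a -> D G b -> D (fun t => F t * G t) (a * G 0 + F 0 * b).

Lemma deriv_mull c F a : D F a -> D (fun t => c * F t) (c * a).
Proof. by move=> /(D_mul (D_cst c)); rewrite mul0r add0r. Qed.

Lemma deriv_sum (I : Type) (r : seq I) (F : I -> R -> T) (a : I -> T) :
  (forall i, D (F i) (a i)) ->
  D (fun t => \sum_(i <- r) F i t) (\sum_(i <- r) a i).
Proof.
move=> Fa; elim: r => [|i r IH].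
  have -> : (fun t => \sum_(i <- [::]) F i t) = (fun=> 0).
    by apply/funext => t; rewrite big_nil.
  by rewrite big_nil; exact: D_cst.
rewrite big_cons; have -> : (fun t => \sum_(k <- i :: r) F k t) =
    (fun t => F i t + \sum_(k <- r) F k t).
  by apply/funext => t; rewrite big_cons.
exact: D_add.
Qed.

Lemma deriv_prod (I : finType) (F : I -> R -> T) (a : I -> T) :
  (forall i, D (F i) (a i)) ->
  D (fun t => \prod_i F i t) (\sum_j \prod_i (if i == j then a i else F i 0)).
Proof.
(* Uniqueness of the index list ensures that each summand differentiates exactly one factor: the
   head does not recur in the tail. *)
move=> Fa; have := index_enum_uniq I; elim: (index_enum I) => [_|i r IH].
  have -> : (fun t => \prod_(i <- [::]) F i t) = (fun=> 1).
    by apply/funext => t; rewrite big_nil.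
  by rewrite big_nil; exact: D_cst.
rewrite /= => /andP[ir ur]; have -> : (fun t => \prod_(k <- i :: r) F k t) =
    (fun t => F i t * \prod_(k <- r) F k t).
  by apply/funext => t; rewrite big_cons.
suff -> : \sum_(j <- i :: r) \prod_(k <- i :: r) (if k == j then a k else F k 0) =
    a i * \prod_(k <- r) F k 0 +
    F i 0 * \sum_(j <- r) \prod_(k <- r) (if k == j then a k else F k 0).
  exact: D_mul (IH ur).
rewrite big_cons big_cons eqxx; congr (_ * _ + _).
  by apply: eq_big_seq => k kr; case: eqP ir => // <-; rewrite kr.
rewrite mulr_sumr; apply: eq_big_seq => j jr; rewrite big_cons.
by case: eqP ir => // ->; rewrite jr.
Qed.

(** The common shape of the determinant and of the top exterior power: [S] is a group of
    permutations and [c] the sign. *)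
Lemma deriv_sum_prod (S I : finType) (c : S -> T)
    (F : I -> S -> R -> T) (a : I -> S -> T) :
  (forall i s, D (F i s) (a i s)) ->
  D (fun t => \sum_s c s * \prod_i F i s t)
    (\sum_j \sum_s c s * \prod_i (if i == j then a i s else F i s 0)).
Proof.
move=> Fa; rewrite exchange_big /=.
apply: deriv_sum => s; rewrite -mulr_sumr; apply: deriv_mull.
by apply: (deriv_prod (F := fun i => F i s)) => i.
Qed.

End LeibnizRule.

(** * Linearization of the real Monge-Ampere equation *)

Section RealLinearization.
Context {R : realType}.

Lemma is_derive_const_eq0 (F : R -> R) (c l eps : R) : 0 < eps ->
  (forall t, `|t| < eps -> F t = c) -> is_derive (0 : R) 1 F l -> l = 0.
Proof.
move=> eps0 Fc [_ <-]; rewrite -[RHS](derive_cst c (0 : R) (1 : R)).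
apply: near_eq_derive; apply/nbhs_ballP; exists eps => // t.
by rewrite -ball_normE /= sub0r normrN => /Fc.
Qed.

Lemma is_derive_mul (F G : R -> R) a b :
  is_derive (0 : R) 1 F a -> is_derive (0 : R) 1 G b ->
  is_derive (0 : R) 1 (fun t => F t * G t) (a * G 0 + F 0 * b).
Proof.
move=> Fa Gb; apply: is_derive_eq (is_deriveM Fa Gb) _.
by rewrite /GRing.scale/= addrC mulrC.
Qed.

(** Jacobi's formula. The Leibniz rule replaces one row of [A 0] by that of [B]; expansion along
    this row involves only cofactors that the replacement leaves unchanged. *)
Lemma is_derive_det n (A : R -> 'M[R]_n) (B : 'M[R]_n) :
  (forall i j, is_derive (0 : R) 1 (fun t => A t i j) (B i j)) ->
  is_derive (0 : R) 1 (fun t => \det (A t)) (\sum_i \sum_j B i j * cofactor (A 0) i j).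
Proof.
move=> AB.
pose M k := \matrix_(i, j) (if i == k then B i j else A 0 i j).
have -> : \sum_i \sum_j B i j * cofactor (A 0) i j = \sum_k \det (M k).
  apply: eq_bigr => k _; rewrite (expand_det_row _ k); apply: eq_bigr => j _.
  rewrite mxE eqxx; congr (_ * (_ * \det _)); apply/matrixP => i l.
  by rewrite !mxE eq_sym (negPf (neq_lift _ _)).
have -> : \sum_k \det (M k) = \sum_k \sum_(s : 'S_n)
    (-1) ^+ s * \prod_i (if i == k then B i (s i) else A 0 i (s i)).
  apply: eq_bigr => k _; apply: eq_bigr => s _; congr (_ * _).
  by apply: eq_bigr => i _; rewrite mxE.
pose D (F : R -> R) l := is_derive (0 : R) 1 F l.
have Dcst c : D (fun=> c) 0 by exact: is_derive_cst.
have Dadd F G a b : D F a -> D G b -> D (fun t => F t + G t) (a + b).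
  by move=> Fa Gb; exact: is_deriveD.
exact: (deriv_sum_prod Dcst Dadd is_derive_mul (fun s : 'S_n => (-1) ^+ s)
  (F := fun i s t => A t i (s i)) (fun i s => AB i (s i))).
Qed.

Lemma hessianE n (u : 'rV[R]_n -> R) y i j :
  hessian u y i j = 'D_(evec i) ('D_(evec j) u) y.
Proof. exact: mxE. Qed.

(** The determinant is constant in t, so the sum in Jacobi's formula vanishes. Symmetry of
    [hessian h y] turns this entrywise pairing with the cofactors into the trace in [L_real]. *)
Lemma L_real_variation n (Om : set 'rV[R]_n) (f : 'rV[R]_n -> R) (eps : R)
    (ut : R -> 'rV[R]_n -> R) u (h : 'rV[R]_n -> R) y :
  0 < eps -> open Om -> Om y -> (forall z, Om z -> ut 0 z = u z) ->
  class_C 2 Om h ->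
  (forall t, `|t| < eps -> \det (hessian (ut t) y) = f y) ->
  (forall s, is_derive (0 : R) 1 (fun t => iter_derive s (ut t) y) (iter_derive s h y)) ->
  L_real u h y = 0.
Proof.
move=> eps0 oOm Omy utu h2 MA dut.
have uE : hessian (ut 0) y = hessian u y.
  apply/matrixP => i j.
  apply: etrans (hessianE _ _ _ _) (etrans _ (esym (hessianE _ _ _ _))).
  exact: (iter_derive_eq_on [:: evec i; evec j] oOm utu Omy).
have hsym i j : hessian h y i j = hessian h y j i.
  by rewrite !hessianE; exact: (class_C2_deriveC _ _ oOm h2 Omy).
have dA i j : is_derive (0 : R) 1 (fun t => hessian (ut t) y i j) (hessian h y i j).
  have -> : (fun t => hessian (ut t) y i j) =
      (fun t => iter_derive [:: evec i; evec j] (ut t) y).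
    by apply/funext => t; exact: hessianE.
  by rewrite hessianE; exact: dut.
rewrite -(is_derive_const_eq0 eps0 MA (is_derive_det dA)) uE.
apply: eq_bigr => i _; rewrite mxE; apply: eq_bigr => j _.
by rewrite hsym mxE mulrC.
Qed.

End RealLinearization.

(** * Linearization of the complex Monge-Ampere equation *)

Section ComplexLinearization.
Context {R : realType} {n : nat}.
Local Open Scope complex_scope.
Implicit Types (Om : set (Cn R n)) (u h : Cn R n -> R).

(** Complex-valued functions of a real variable are differentiated componentwise; this is the
    instance of [D] for the Leibniz rules over [R[i]]. *)
Definition is_deriveC (F : R -> R[i]) (l : R[i]) : Prop :=
  is_derive (0 : R) 1 (fun t => complex.Re (F t)) (complex.Re l) /\
  is_derive (0 : R) 1 (fun t => complex.Im (F t)) (complex.Im l).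

Lemma is_deriveC_cst c : is_deriveC (fun=> c) 0.
Proof. by split; exact: is_derive_cst. Qed.

Let ReD (x y : R[i]) : complex.Re (x + y) = complex.Re x + complex.Re y.
Proof. by case: x y => [a b] [c d]. Qed.

Let ImD (x y : R[i]) : complex.Im (x + y) = complex.Im x + complex.Im y.
Proof. by case: x y => [a b] [c d]. Qed.

Let ReM (x y : R[i]) : complex.Re (x * y) =
  complex.Re x * complex.Re y - complex.Im x * complex.Im y.
Proof. by case: x y => [a b] [c d]. Qed.

Let ImM (x y : R[i]) : complex.Im (x * y) =
  complex.Re x * complex.Im y + complex.Im x * complex.Re y.
Proof. by case: x y => [a b] [c d]. Qed.

Lemma is_deriveC_add F G a b :
  is_deriveC F a -> is_deriveC G b -> is_deriveC (fun t => F t + G t) (a + b).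
Proof.
move=> [Fr Fi] [Gr Gi]; split.
  have -> : (fun t => complex.Re (F t + G t)) =
      (fun t => complex.Re (F t)) + (fun t => complex.Re (G t)).
    by apply/funext => t; exact: ReD.
  by rewrite ReD; exact: is_deriveD.
have -> : (fun t => complex.Im (F t + G t)) =
    (fun t => complex.Im (F t)) + (fun t => complex.Im (G t)).
  by apply/funext => t; exact: ImD.
by rewrite ImD; exact: is_deriveD.
Qed.

Lemma is_deriveC_mul F G a b : is_deriveC F a -> is_deriveC G b ->
  is_deriveC (fun t => F t * G t) (a * G 0 + F 0 * b).
Proof.
move=> [Fr Fi] [Gr Gi]; split.
  have -> : (fun t => complex.Re (F t * G t)) =
      (fun t => complex.Re (F t) * complex.Re (G t)) -
      (fun t => complex.Im (F t) * complex.Im (G t)).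
    by apply/funext => t; exact: ReM.
  apply: is_derive_eq (is_deriveB (is_derive_mul Fr Gr) (is_derive_mul Fi Gi)) _.
  by rewrite ReD !ReM; ring.
have -> : (fun t => complex.Im (F t * G t)) =
    (fun t => complex.Re (F t) * complex.Im (G t)) +
    (fun t => complex.Im (F t) * complex.Re (G t)).
  by apply/funext => t; exact: ImM.
apply: is_derive_eq (is_deriveD (is_derive_mul Fr Gi) (is_derive_mul Fi Gr)) _.
by rewrite ImD !ImM; ring.
Qed.

Lemma is_deriveC_mull c F a :
  is_deriveC F a -> is_deriveC (fun t => c * F t) (c * a).
Proof. exact: deriv_mull is_deriveC_cst is_deriveC_mul c F a. Qed.

Lemma is_deriveC_sum (I : Type) (r : seq I) (F : I -> R -> R[i]) (a : I -> R[i]) :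
  (forall i, is_deriveC (F i) (a i)) ->
  is_deriveC (fun t => \sum_(i <- r) F i t) (\sum_(i <- r) a i).
Proof. exact: deriv_sum is_deriveC_cst is_deriveC_add I r F a. Qed.

Lemma is_deriveC_near (F G : R -> R[i]) a (eps : R) : 0 < eps ->
  (forall t, `|t| < eps -> F t = G t) -> is_deriveC G a -> is_deriveC F a.
Proof.
move=> eps0 FG [Gr Gi].
have FGnear : \forall t \near (0 : R), F t = G t.
  apply/nbhs_ballP; exists eps => // t.
  by rewrite -ball_normE /= sub0r normrN => /FG.
split; [apply: near_eq_is_derive Gr|apply: near_eq_is_derive Gi];
  by apply: filterS FGnear => t ->.
Qed.

Lemma is_deriveC_const_eq0 F c l (eps : R) : 0 < eps ->
  (forall t, `|t| < eps -> F t = c) -> is_deriveC F l -> l = 0.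
Proof.
move=> eps0 Fc [Fr Fi]; apply/eqP; rewrite eq_complex; apply/andP; split; apply/eqP.
- by apply: is_derive_const_eq0 eps0 _ Fr => t /Fc->.
- by apply: is_derive_const_eq0 eps0 _ Fi => t /Fc->.
Qed.

Let half_complexE (a b : R) :
  2^-1 * ((a +i* 0) + (0 +i* 1) * (b +i* 0)) = (2^-1 * a) +i* (2^-1 * b).
Proof.
have -> : (2^-1 : R[i]) = (2^-1)%:C by rewrite fmorphV rmorph_nat.
apply/eqP; rewrite eq_complex; apply/andP.
by split; apply/eqP; rewrite ?(ReM, ImM, ReD, ImD) /=; ring.
Qed.

Lemma d_zbar_real k u (q : Cn R n) : d_zbar k (fun p => (u p)%:C) q =
  (2^-1 * 'D_(xvec k) u q) +i* (2^-1 * 'D_(yvec k) u q).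
Proof.
have D0 v : 'D_v (fun p : Cn R n => complex.Im (u p)%:C) q = 0.
  exact: derive_cst.
by rewrite /d_zbar /deriveC !D0; exact: half_complexE.
Qed.

(* The coefficient u_{j kbar} of the Levi form in terms of the real second
   derivatives [a v w = 'D_v ('D_w u)]. *)
Definition levi_entry (j k : 'I_n) (a : Cn R n -> Cn R n -> R) : R[i] :=
  2^-1 * (((2^-1 * a (xvec j) (xvec k)) +i* (2^-1 * a (xvec j) (yvec k))) -
  (0 +i* 1) * ((2^-1 * a (yvec j) (xvec k)) +i* (2^-1 * a (yvec j) (yvec k)))).

Let derive_scaled (f g : Cn R n -> R) (c : R) y v :
  f = (fun q => c * g q) -> derivable g y v -> 'D_v f y = c * 'D_v g y.
Proof. by move=> -> gv; exact: deriveMl. Qed.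

Lemma d_z_zbarE Om j k u y : class_C 2 Om u -> Om y ->
  d_z_zbar j k u y = levi_entry j k (fun v w => 'D_v ('D_w u) y).
Proof.
(* Existence of the second derivatives lets the factor 1/2 from [d_zbar] leave the outer
   derivative. *)
move=> u2 Omy; have du v w : derivable ('D_w u) y v.
  exact: (@class_C_derivable _ _ 2 Om u [:: w]).
have ReE : (fun q => complex.Re (d_zbar k (fun p => (u p)%:C) q)) =
    (fun q => 2^-1 * 'D_(xvec k) u q) by apply/funext => q; rewrite d_zbar_real.
have ImE : (fun q => complex.Im (d_zbar k (fun p => (u p)%:C) q)) =
    (fun q => 2^-1 * 'D_(yvec k) u q) by apply/funext => q; rewrite d_zbar_real.
have dC v : deriveC v (d_zbar k (fun p => (u p)%:C)) y =
    (2^-1 * 'D_v ('D_(xvec k) u) y) +i* (2^-1 * 'D_v ('D_(yvec k) u) y).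
  congr Complex.
  - exact: (derive_scaled ReE (du v (xvec k))).
  - exact: (derive_scaled ImE (du v (yvec k))).
by congr (_ * (_ - _ * _)); exact: dC.
Qed.

(* Exchanging two of the 2-forms amounts to composing s with the product of two
   transpositions, an even permutation. *)
Lemma wedge_tperm (a : 'I_n -> form2) i j (v : 'I_n * bool -> Cn R n) :
  wedge (a \o tperm i j) v = wedge a v.
Proof.
pose s0 := (tperm (i, false) (j, false) * tperm (i, true) (j, true))%g.
have same k b : tperm (i, b) (j, b) (k, b) = (tperm i j k, b).
  by rewrite -(@inj_tperm _ _ (fun k => (k, b)))// => ? ? [].
have other k b : tperm (i, ~~ b) (j, ~~ b) (k, b) = (k, b).
  by rewrite tpermD// xpair_eqE; case: b; rewrite andbF.
have s0E k b : s0 (k, b) = (tperm i j k, b).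
  by rewrite permM; case: b; rewrite ?same ?(other _ true) ?(other _ false)// same.
have s0_even : odd_perm s0 = false.
  by rewrite odd_permM !odd_tperm !xpair_eqE !eqxx !andbT addbb.
(* Composing with the even [s0] permutes the sum and keeps all signs; reindexing each product by
   [tperm i j] then moves the exchange from the arguments to the forms. *)
rewrite /wedge [in RHS](reindex_inj (mulgI s0)) /=; congr (_ * _).
apply: eq_bigr => s _; rewrite odd_permM s0_even; congr (_ * _).
rewrite [RHS](reindex_inj (@perm_inj _ (tperm i j))) /=.
by apply: eq_bigr => k _; rewrite !(permM s0) !s0E tpermK.
Qed.

Lemma is_deriveC_wedge (a : R -> form2) (b : form2) v :
  (forall x y, is_deriveC (fun t => a t x y) (b x y)) ->
  is_deriveC (fun t => wedge (fun _ : 'I_n => a t) v)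
    (\sum_j wedge (fun k : 'I_n => if k == j then b else a 0) v).
Proof.
move=> ab; rewrite -mulr_sumr; apply: is_deriveC_mull.
have -> : \sum_(j : 'I_n) \sum_(s : {perm 'I_n * bool}) (-1) ^+ s *
      \prod_k (if k == j then b else a 0) (v (s (k, false))) (v (s (k, true))) =
    \sum_(j : 'I_n) \sum_(s : {perm 'I_n * bool}) (-1) ^+ s *
      \prod_k (if k == j then b (v (s (k, false))) (v (s (k, true)))
               else a 0 (v (s (k, false))) (v (s (k, true)))).
  apply: eq_bigr => j _; apply: eq_bigr => s _; congr (_ * _).
  by apply: eq_bigr => k _; case: ifP.
exact: (deriv_sum_prod is_deriveC_cst is_deriveC_add is_deriveC_mul
  (fun s : {perm 'I_n * bool} => (-1) ^+ s)
  (F := fun k s t => a t (v (s (k, false))) (v (s (k, true))))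
  (fun k s => ab (v (s (k, false))) (v (s (k, true))))).
Qed.

(** [ddc] as a linear function of the Levi coefficients: with [d_z_zbar] for [a] it unfolds to
    [ddc c u p], so derivatives and equalities can be checked on coefficients. *)
Definition ddc_of_levi (c : R) (a : 'I_n -> 'I_n -> R[i]) : form2 := fun v w =>
  c%:C * ((0 +i* 1) * \sum_j \sum_k a j k * wedge1 (dz j) (dzbar k) v w).

Lemma is_deriveC_ddc_of_levi (c : R) (a : R -> 'I_n -> 'I_n -> R[i]) b v w :
  (forall j k, is_deriveC (fun t => a t j k) (b j k)) ->
  is_deriveC (fun t => ddc_of_levi c (a t) v w) (ddc_of_levi c b v w).
Proof.
move=> ab; do 2!apply: is_deriveC_mull; apply: is_deriveC_sum => j.
apply: is_deriveC_sum => k; under eq_fun do rewrite mulrC; rewrite mulrC.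
exact: is_deriveC_mull.
Qed.

Lemma is_deriveC_levi_entry j k (a : R -> Cn R n -> Cn R n -> R) b :
  (forall v w, is_derive (0 : R) 1 (fun t => a t v w) (b v w)) ->
  is_deriveC (fun t => levi_entry j k (a t)) (levi_entry j k b).
Proof.
move=> ab.
have ab2 v w : is_derive (0 : R) 1 (fun t => 2^-1 * a t v w) (2^-1 * b v w).
  apply: is_derive_eq (is_derive_mul (is_derive_cst _ _ _) (ab v w)) _.
  by rewrite mul0r add0r.
(* The sign is absorbed into the constant i, making the difference a sum to which additivity
   applies. *)
apply: is_deriveC_mull; rewrite -mulNr; under eq_fun do rewrite -mulNr.
by apply: is_deriveC_add; [split|apply: is_deriveC_mull; split]; exact: ab2.
Qed.

Lemma L_complex_variation (c : R) Om (f : Cn R n -> R) (eps : R)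
    (ut : R -> Cn R n -> R) u h y :
  (0 < n)%N -> 0 < eps -> open Om -> Om y -> (forall z, Om z -> ut 0 z = u z) ->
  class_C 2 Om u -> (forall t, `|t| < eps -> class_C 2 Om (ut t)) -> class_C 2 Om h ->
  (forall t, `|t| < eps -> dV_coef (wedge (fun=> ddc c (ut t) y)) = (f y)%:C) ->
  (forall s, is_derive (0 : R) 1 (fun t => iter_derive s (ut t) y) (iter_derive s h y)) ->
  L_complex c u h y = 0.
Proof.
move=> n0 eps0 oOm Omy utu u2 ut2 h2 MA dut.
have eps00 : `|0 : R| < eps by rewrite normr0.
have uE : ddc c u y = ddc c (ut 0) y.
  apply: (congr1 (ddc_of_levi c)); apply/funext => j; apply/funext => k.
  apply: etrans (d_z_zbarE j k u2 Omy) _.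
  apply: etrans _ (esym (d_z_zbarE j k (ut2 0 eps00) Omy)).
  apply: (congr1 (levi_entry j k)); apply/funext => v; apply/funext => w.
  exact: esym (iter_derive_eq_on [:: v; w] oOm utu Omy).
have dzz j k : is_deriveC (fun t => d_z_zbar j k (ut t) y) (d_z_zbar j k h y).
  rewrite (d_z_zbarE j k h2 Omy).
  apply: (is_deriveC_near eps0 (fun t tE => d_z_zbarE j k (ut2 t tE) Omy)).
  exact: (is_deriveC_levi_entry j k (fun v w => dut [:: v; w])).
have dddc v w : is_deriveC (fun t => ddc c (ut t) y v w) (ddc c h y v w).
  exact: (is_deriveC_ddc_of_levi c v w dzz).
(* Since the top power of [ddc c (ut t) y] is constant in t, its Leibniz sum over the slots
   vanishes; it remains to identify [L_complex] with that sum. *)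
apply: etrans _ (is_deriveC_const_eq0 eps0 MA (is_deriveC_wedge _ dddc)).
rewrite /L_complex uE mulr_natl.
set w0 := dV_coef _; transitivity (\sum_(j < n) w0).
  by rewrite sumr_const card_ord.
apply: eq_bigr => j _.
(* 2-forms commute, so the summand with [ddc c h y] in slot j equals the one with it in slot 0. The
   n equal summands account for the factor n in [L_complex]. *)
rewrite -(wedge_tperm (fun k => if k == j then ddc c h y else ddc c (ut 0) y)
  (Ordinal n0) j).
congr (wedge _ _); apply/funext => k /=.
by rewrite (can2_eq (tpermK _ _) (tpermK _ _)) tpermR.
Qed.

End ComplexLinearization.

(** * From the linearized equation to harmonic measure, and the two settings *)

Lemma harmonic_measure_variation (R : realType) (E : normedModType R) (T : zmodType)
    (Om : set E) (L : (E -> R) -> E -> T) (phi psi : E -> R) (ut : R -> E -> R)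
    (eps : R) (x : E) (omega : {measure set (borel E) -> \bar R}) :
  0 < eps -> open Om -> smooth_family eps Om ut ->
  (forall t y, `|t| < eps -> boundary Om y -> ut t y = phi y + t * psi y) ->
  Om x -> is_harmonic_measure Om L x omega ->
  (forall h, class_C 2 Om h ->
    (forall s y, Om y ->
      is_derive (0 : R) 1 (fun t => iter_derive s (ut t) y) (iter_derive s h y)) ->
    forall y, Om y -> L h y = 0) ->
  derivable (fun t : R => ut t x) 0 1 /\
  (derive1 (fun t : R => ut t x) 0)%:E = (\int[omega]_(y in boundary Om) (psi y)%:E)%E.
Proof.
move=> eps0 oOm utC utb Omx [_ omegaE] Lh.
have [h [h2 hcont hb hut]] := variation_extension eps0 oOm utC utb.
(* The empty list of directions gives the t-derivative of [ut t x] itself, equal to [h x]; then [h]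
   is the test function, with boundary values [psi], in the definition of harmonic measure. *)
have [dutx dE] := hut [::] x Omx; split; first exact: dutx.
rewrite derive1E; apply: etrans (congr1 EFin dE) _.
exact: omegaE h2 hcont (Lh h h2 hut) hb.
Qed.

Unset Implicit Arguments.

Theorem corollary6p3 (R : realType) (n : nat) (n_gt0 : (0 < n)%N) :
  (forall (Om : set 'rV[R]_n) (f phi psi u : 'rV[R]_n -> R)
      (ut : R -> 'rV[R]_n -> R) (eps : R) (x : 'rV[R]_n)
      (omega : {measure set (borel 'rV[R]_n) -> \bar R}),
    bounded_domain Om -> smooth_boundary Om -> uniformly_convex Om ->
    smooth_closure Om f -> (forall y, closure Om y -> 0 < f y) ->
    real_MA_solution Om f phi u ->
    Om x -> is_harmonic_measure Om (L_real u) x omega ->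
    0 < eps ->
    (forall t, `|t| < eps ->
       real_MA_solution Om f (fun y => phi y + t * psi y) (ut t)) ->
    (forall y, closure Om y -> ut 0 y = u y) ->
    smooth_family eps Om ut ->
    derivable (fun t : R => ut t x) 0 1 /\
    (derive1 (fun t : R => ut t x) 0)%:E =
      (\int[omega]_(y in boundary Om) (psi y)%:E)%E)
  /\
  (forall (c : R) (Om : set (Cn R n)) (f phi psi u : Cn R n -> R)
      (ut : R -> Cn R n -> R) (eps : R) (x : Cn R n)
      (omega : {measure set (borel (Cn R n)) -> \bar R}),
    0 < c ->
    bounded_domain Om -> smooth_boundary Om -> strongly_pseudoconvex Om ->
    smooth_closure Om f -> (forall y, closure Om y -> 0 < f y) ->
    complex_MA_solution c Om f phi u ->
    Om x -> is_harmonic_measure Om (L_complex c u) x omega ->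
    0 < eps ->
    (forall t, `|t| < eps ->
       complex_MA_solution c Om f (fun y => phi y + t * psi y) (ut t)) ->
    (forall y, closure Om y -> ut 0 y = u y) ->
    smooth_family eps Om ut ->
    derivable (fun t : R => ut t x) 0 1 /\
    (derive1 (fun t : R => ut t x) 0)%:E =
      (\int[omega]_(y in boundary Om) (psi y)%:E)%E).
Proof.
split.
- move=> Om f phi psi u ut eps x omega [oOm _ _ _] _ _ _ _ _ Omx omegaE eps0 utMA utu utC.
  apply: (harmonic_measure_variation eps0 oOm utC _ Omx omegaE).
    by move=> t y /utMA[_ _ _]; exact.
  move=> h h2 hut y Omy.
  apply: (L_real_variation (f := f) eps0 oOm Omy _ h2 _ (fun s => hut s y Omy)).
    by move=> z /subset_closure /utu.
  by move=> t /utMA[_ _ MA _]; exact: MA.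
- move=> c Om f phi psi u ut eps x omega _ [oOm _ _ _] _ _ _ _ uMA Omx omegaE
    eps0 utMA utu utC.
  apply: (harmonic_measure_variation eps0 oOm utC _ Omx omegaE).
    by move=> t y /utMA[_ _ _]; exact.
  move=> h h2 hut y Omy.
  (* Positivity of n supplies the slot 0 in which [L_complex] places [ddc c h]. *)
  apply: (L_complex_variation (f := f) n_gt0 eps0 oOm Omy _ _ _ h2 _ (fun s => hut s y Omy)).
  + by move=> z /subset_closure /utu.
  + by case: uMA => -[uC _ _] _ _ _; exact: uC.
  + by move=> t /utMA[[utC2 _ _] _ _ _]; exact: utC2.
  + by move=> t /utMA[_ _ MA _]; exact: MA.
Qed.
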